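(* Let $m$ be a nonnegative integer and $0<q<1$. Then $$\prod_{j=1}^\infty\frac{1}{(1-q^j)^m}=\sum_{n=0}^\infty(-1)^n(1-q^{2n+1})q^{n(n-1)/2}\;{}_{m+2}\phi_{m+1}\left({q^{-n},q^{n+1},0,\dots,0\atop q,q,\dots,q};q,q\right),$$ where in the ${}_{m+2}\phi_{m+1}$ the upper parameters are $q^{-n},q^{n+1}$ followed by $m$ copies of $0$, and the lower parameters are $m+1$ copies of $q$.
   Context: Put $(x;q)_0=1$, $(x;q)_k=\prod_{i=0}^{k-1}(1-xq^i)$. For a nonnegative integer $n$, the terminating basic hypergeometric series is $${}_{r+1}\phi_r\left({q^{-n},a_2,\dots,a_{r+1}\atop b_1,\dots,b_r};q,z\right)=\sum_{k=0}^n\frac{(q^{-n};q)_k(a_2;q)_k\cdots(a_{r+1};q)_k}{(q;q)_k(b_1;q)_k\cdots(b_r;q)_k}z^k .$$ *)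

(* Defs.v *)
From HB Require Import structures.
From mathcomp Require Import all_boot all_order all_algebra.
From mathcomp Require Import all_classical all_reals all_analysis.
Import Order.TTheory GRing.Theory Num.Theory numFieldNormedType.Exports.

Set Implicit Arguments.
Unset Strict Implicit.
Unset Printing Implicit Defensive.

Local Open Scope ring_scope.

Definition qpoch (R : fieldType) (x q : R) (k : nat) : R :=
  \prod_(i < k) (1 - x * q ^+ i).

(* The first upper parameter is q ^- n; [a] lists the other r upper
   parameters a_2, ..., a_{r+1}, and [b] the lower ones b_1, ..., b_r. *)
Definition qhyp (R : fieldType) (n r : nat) (a b : r.-tuple R) (q z : R) : R :=
  \sum_(k < n.+1)
    (qpoch (q ^- n) q k * \prod_(i < r) qpoch (tnth a i) q k)
    / (qpoch q q k * \prod_(i < r) qpoch (tnth b i) q k) * z ^+ k.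

(* Main.v *)
Require Import Defs.
From HB Require Import structures.
From mathcomp Require Import all_boot all_order all_algebra.
From mathcomp Require Import all_classical all_reals all_analysis.
From mathcomp Require Import ring zify.
Import Order.TTheory GRing.Theory Num.Theory numFieldNormedType.Exports.

Set Implicit Arguments.
Unset Strict Implicit.
Unset Printing Implicit Defensive.

(** Write [u_k] for [(q;q)_k] and [u_oo] for its limit, so that the product on
    the left is [u_oo ^- m].  Combining the sign and the power of [q] in front
    of the series with [(q^-n)_k (q^(n+1))_k q^k] gives (lemma [qpoch_pair])

      T_n = sum_(k <= n) (1 - q^(2n+1)) (-1)^(n-k) q^C(n-k,2)
                           u_(n+k) / (u_(n-k) u_k^(m+2)).

    For fixed [k] the sum over [n] telescopes, so the partial sums of the series
    have the closed form (lemma [sum_qhyp_terms])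

      T_0 + ... + T_N = sum_(k <= N) w(N,k) u_(N+k+1) / u_k^(m+1),
      w(N,k) = (-1)^(N-k) q^C(N-k+1,2) / (u_(N-k) u_k).

    Summing over [n] up to infinity for each [k] separately would give [0]: the
    whole value sits in the boundary terms with [k] close to [N].  Indeed the
    weights [w(N,k)] sum to [1] over [k] (lemma [sum_euler_weight], the finite
    form of Euler's expansion of [(q;q)_oo]) and are [O(q^(2(N-k)))], while the
    factor that they average differs from [u_oo / u_oo^(m+1) = u_oo ^- m] by
    [O(q^k)] (lemma [ratio_dist]).  Hence the partial sum differs from
    [u_oo ^- m] by [O(sum_k q^(2(N-k)+k)) = O(q^N)] (lemma [cvg_euler_mean]). *)

Local Open Scope ring_scope.

(** * Finite identities for q-shifted factorials *)

Section Algebra.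
Variables (F : fieldType) (q : F).
Hypothesis q_nroot : forall i, q ^+ i.+1 != 1.

Lemma qpochS (x : F) k : qpoch x q k.+1 = qpoch x q k * (1 - x * q ^+ k).
Proof. by rewrite /qpoch big_ord_recr. Qed.

Lemma qpoch0 (x : F) : qpoch x q 0 = 1.
Proof. by rewrite /qpoch big_ord0. Qed.

Lemma qpoch_at0 k : qpoch 0 q k = 1.
Proof. by rewrite /qpoch big1// => i _; rewrite mul0r subr0. Qed.

Lemma qpochqS k : qpoch q q k.+1 = qpoch q q k * (1 - q ^+ k.+1).
Proof. by rewrite qpochS exprS. Qed.

Lemma qpochq_neq0 k : qpoch q q k != 0.
Proof.
elim: k => [|k IH]; first by rewrite qpoch0 oner_neq0.
by rewrite qpochqS mulf_neq0// subr_eq0 eq_sym.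
Qed.

Lemma binS2 n : 'C(n.+1, 2) = ('C(n, 2) + n)%N.
Proof. by rewrite binS bin1. Qed.

(** Both sides are multiplied by [q (1 - q^(k-n)) (1 - q^(n+1+k))] when [k]
    grows by one: on the right, [1 - q^(k-n) = - q^(k-n) (1 - q^(n-k))] accounts
    for the change of sign and for [C(n-k,2) - C(n-k-1,2) = n-k-1]. *)
Lemma qpoch_pair n k : q != 0 -> (k <= n)%N ->
  (-1) ^+ n * q ^+ 'C(n, 2) * (qpoch (q ^- n) q k * qpoch (q ^+ n.+1) q k)
    * q ^+ k =
  (-1) ^+ (n - k) * q ^+ 'C(n - k, 2) * qpoch q q (n + k)
    / qpoch q q (n - k).
Proof.
move=> q_neq0; elim: k => [|k IH] lekn.
  by rewrite subn0 addn0 !qpoch0 !mulr1 mulfK// qpochq_neq0.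
have {}IH := IH (ltnW lekn).
have En : (n - k = (n - k.+1).+1)%N by lia.
move: IH; rewrite En; set d := (n - k.+1)%N => IH.
have nE : n = (k + d.+1)%N by rewrite /d; lia.
rewrite !qpochS addnS qpochqS.
rewrite [LHS](_ : _ = ((-1) ^+ n * q ^+ 'C(n, 2) *
  (qpoch (q ^- n) q k * qpoch (q ^+ n.+1) q k) * q ^+ k) *
  ((1 - q ^- n * q ^+ k) * (1 - q ^+ n.+1 * q ^+ k) * q)); last first.
  by rewrite (exprS q k); ring.
rewrite IH binS2 qpochqS -exprD addSn.
have -> : q ^- n * q ^+ k = q ^- d.+1.
  by rewrite nE exprD invfM mulrAC mulVf ?mul1r// expf_neq0.
have := qpochq_neq0 d; have := q_nroot d.
rewrite eq_sym -subr_eq0 !exprS !exprD.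
have := expf_neq0 d q_neq0.
by move=> h1 h2 h3; field; rewrite h1 h2 h3 q_neq0.
Qed.

(** The summands of Euler's expansion of [(q;q)_N], normalized to have total
    [1]; the summation index of Euler's expansion is [N - k]. *)
Definition euler_weight N k : F :=
  (-1) ^+ (N - k) * q ^+ 'C((N - k).+1, 2)
  / (qpoch q q (N - k) * qpoch q q k).

(** Passing from [N - 1] to [N], each [k < N] is a telescoping step: with
    [d = N - k] it reads
    [q^d (1 - q^(2k+d+1)) + (1 - q^d) = 1 - q^(2k+2d+1)], up to a common factor.
    The new index [k = N] contributes [(1 - q^(2N+1)) u_(2N) = u_(2N+1)]. *)
Lemma sum_qhyp_terms m N :
  \sum_(0 <= n < N.+1) \sum_(k < n.+1)
    ((1 - q ^+ n.*2.+1) * ((-1) ^+ (n - k) * q ^+ 'C(n - k, 2) *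
     qpoch q q (n + k) / qpoch q q (n - k)) / qpoch q q k ^+ m.+2)
  = \sum_(k < N.+1) euler_weight N k *
      (qpoch q q (N + k).+1 / qpoch q q k ^+ m.+1).
Proof.
elim: N => [|N IH].
  rewrite big_nat1 !big_ord1 /euler_weight/= !qpochqS !qpoch0 !expr0 !expr1n.
  by rewrite !(mulr1, mul1r, invr1).
rewrite big_nat_recr//= {}IH [in RHS]big_ord_recr [X in _ + X]big_ord_recr/=.
rewrite addrA -big_split/=; congr (_ + _); last first.
  rewrite /euler_weight subnn addnn [qpoch q q _.*2.+1]qpochqS !qpoch0 !expr0.
  have := qpochq_neq0 N.+1; set v := qpoch q q N.+1 => v0.
  have vm : v ^+ m != 0 by rewrite expf_neq0.
  by rewrite !(exprS v); field; rewrite v0 vm oner_neq0.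
apply: eq_bigr => -[k /= lekN] _; rewrite /euler_weight.
have := qpochq_neq0 k; set v := qpoch q q k => v0.
have -> : (N.+1 - k = (N - k).+1)%N by lia.
set d := (N - k)%N; have NE : N = (k + d)%N by rewrite /d; lia.
rewrite addSn !binS2 [qpoch q q (N + k).+2]qpochqS [qpoch q q d.+1]qpochqS.
set w := qpoch q q (N + k).+1.
have -> : q ^+ (N + k).+2 = q ^+ k ^+ 2 * q ^+ d.+1 * q.
  by rewrite -exprM -exprD -exprSr; congr (_ ^+ _); lia.
have -> : q ^+ (N.+1).*2.+1 = q ^+ k ^+ 2 * q ^+ d.+1 ^+ 2 * q.
  by rewrite -!exprM -exprD -exprSr; congr (_ ^+ _); lia.
have h1 := q_nroot d; rewrite eq_sym -subr_eq0 in h1.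
have h2 := qpochq_neq0 d; move: h1.
rewrite !exprD [(-1) ^+ d.+1]exprS; set Q := q ^+ d.+1; set s := (-1) ^+ d.
have vm : v ^+ m != 0 by rewrite expf_neq0.
by rewrite !(exprSr v) => h1; field; rewrite h1 h2 v0 vm.
Qed.

(** The splitting [1 - q^(N+1) = (1 - q^k) + q^k (1 - q^(N+1-k))] turns
    [(1 - q^(N+1)) w(N+1,k)] into [w(N,k-1) - q^(N+1) w(N,k)], so the total
    [E_N] satisfies [(1 - q^(N+1)) E_(N+1) = (1 - q^(N+1)) E_N]. *)
Lemma sum_euler_weight N : \sum_(k < N.+1) euler_weight N k = 1.
Proof.
elim: N => [|N IH].
  rewrite big_ord1 /euler_weight/= subnn !qpoch0 bin_small// !expr0.
  by rewrite !mulr1 invr1 mulr1.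
have := q_nroot N; rewrite eq_sym -subr_eq0 => qN.
apply: (mulfI qN); rewrite mulr1 mulr_sumr.
have step k : (k <= N.+1)%N -> (1 - q ^+ N.+1) * euler_weight N.+1 k =
    (if k is k'.+1 then euler_weight N k' else 0)
    - (if (k <= N)%N then q ^+ N.+1 * euler_weight N k else 0).
  case: k => [_|k lekN].
    rewrite leq0n /euler_weight !subn0 !qpoch0 !qpochqS [in LHS]binS2.
    have h := qpochq_neq0 N.
    by rewrite exprD [(-1) ^+ N.+1]exprS; field; rewrite h qN.
  have h := qpochq_neq0 k.
  have hk := q_nroot k; rewrite eq_sym -subr_eq0 in hk.
  rewrite /euler_weight subSS; case: ifPn => [ltkN|leNk].
    have -> : (N - k = (N - k.+1).+1)%N by lia.
    set d := (N - k.+1)%N; have NE : N.+1 = (k.+1 + d.+1)%N by rewrite /d; lia.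
    have hd := qpochq_neq0 d.
    have hd' := q_nroot d; rewrite eq_sym -subr_eq0 in hd'.
    rewrite NE !binS2 !qpochqS !exprD [(-1) ^+ d.+1]exprS.
    by field; rewrite h hk hd hd'.
  have -> : k = N by lia.
  rewrite !subnn !qpochqS qpoch0 !expr0.
  have hN := qpochq_neq0 N.
  by field; rewrite hN qN.
under eq_bigr => k _ do rewrite step -1?ltnS//.
rewrite big_split/= big_ord_recl/= add0r IH sumrN big_ord_recr/= ltnn addr0.
congr (_ - _).
rewrite (eq_bigr (fun k : 'I_N.+1 => q ^+ N.+1 * euler_weight N k)); last first.
  by move=> k _; rewrite ltn_ord.
by rewrite /= -mulr_sumr IH mulr1.
Qed.

End Algebra.

(** * The infinite product and rates of convergence *)

Section Analysis.
Local Open Scope classical_set_scope.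
Local Open Scope ring_scope.
Variables (R : realType) (q : R).
Hypotheses (q_gt0 : 0 < q) (q_lt1 : q < 1).

Lemma q_expn_neq1 i : q ^+ i.+1 != 1.
Proof. by rewrite lt_eqF// exprn_ilt1// ltW. Qed.

Lemma qpoch_gt0 n : 0 < qpoch q q n.
Proof.
rewrite /qpoch prodr_gt0// => i _.
by rewrite -exprS subr_gt0 exprn_ilt1// ltW.
Qed.

Lemma qpoch_nincr : nonincreasing_seq (qpoch q q).
Proof.
apply/nonincreasing_seqP => n; rewrite qpochqS.
by rewrite ger_pMr ?qpoch_gt0// gerBl exprn_ge0// ltW.
Qed.

(** The quotient [u_l / u_n] is the product of the [1 - q^i], [n < i <= l],
    hence at least [1 - sum_(i > n) q^i].  This one inequality yields both the
    positivity of the infinite product and the geometric rate of convergence.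
    It holds because the left-hand side is nondecreasing in [n]. *)
Lemma qpoch_tail n l : (n <= l)%N ->
  qpoch q q n * (1 - q ^+ n.+1 / (1 - q)) <= qpoch q q l.
Proof.
move=> nl.
suff incr : nondecreasing_seq
    (fun i => qpoch q q i * (1 - q ^+ i.+1 / (1 - q))).
  apply: (le_trans (incr _ _ nl)); rewrite ger_pMr ?qpoch_gt0// gerBl.
  by rewrite divr_ge0 ?exprn_ge0 ?subr_ge0 ?ltW.
apply/nondecreasing_seqP => i; rewrite qpochqS -mulrA ler_pM2l ?qpoch_gt0//.
rewrite [q ^+ i.+2]exprSr; set x := q ^+ i.+1.
have x0 : 0 < x by rewrite exprn_gt0.
have q1 : 1 - q != 0 by rewrite subr_eq0 gt_eqF.
rewrite -subr_ge0.
rewrite [leRHS](_ : _ = x * x * q / (1 - q)); last by field.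
by rewrite divr_ge0 ?subr_ge0 ?mulr_ge0 ?ltW.
Qed.

Definition qpoch_oo : R := limn (qpoch q q).

Lemma cvg_qpoch : qpoch q q @ \oo --> qpoch_oo.
Proof.
apply: nonincreasing_is_cvgn; first exact: qpoch_nincr.
by exists 0 => _ [n _ <-]; rewrite ltW// qpoch_gt0.
Qed.

Lemma qpoch_oo_le n : qpoch_oo <= qpoch q q n.
Proof.
apply: nonincreasing_cvgn_ge; first exact: qpoch_nincr.
exact: cvgP cvg_qpoch.
Qed.

Lemma qpoch_oo_ge n : qpoch q q n * (1 - q ^+ n.+1 / (1 - q)) <= qpoch_oo.
Proof.
apply: limr_ge; first exact: cvgP cvg_qpoch.
by exists n => // l /= nl; exact: qpoch_tail.
Qed.

Lemma cvg_qn : (fun n => q ^+ n) @ \oo --> 0.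
Proof. by apply: cvg_expr; rewrite ger0_norm ?ltW. Qed.

(** As soon as [q^n < 1 - q], the lower bound [qpoch_oo_ge] is positive. *)
Lemma qpoch_oo_gt0 : 0 < qpoch_oo.
Proof.
have q1 : 0 < 1 - q by rewrite subr_gt0.
have /cvgrPdist_lt/(_ _ q1)[n _ /(_ n (leqnn n))/=] := cvg_qn.
rewrite sub0r normrN ger0_norm ?exprn_ge0 ?ltW// => qn.
apply: lt_le_trans (qpoch_oo_ge n).
rewrite mulr_gt0 ?qpoch_gt0// subr_gt0 ltr_pdivrMr// mul1r.
by rewrite exprS (le_lt_trans _ qn)// ger_pMl ?exprn_gt0// ltW.
Qed.

Lemma qpoch_le1 n : qpoch q q n <= 1.
Proof. by rewrite -(qpoch0 q q); exact: qpoch_nincr. Qed.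

Lemma qpoch_dist n : `|qpoch q q n - qpoch_oo| <= q ^+ n / (1 - q).
Proof.
rewrite ger0_norm ?subr_ge0 ?qpoch_oo_le// lerBlDr -lerBlDl.
apply: le_trans (qpoch_oo_ge n); rewrite mulrBr mulr1 lerB//.
rewrite mulrA ler_pM2r ?invr_gt0 ?subr_gt0//.
rewrite exprS mulrA ger_pMl ?exprn_gt0//.
by rewrite mulr_ile1 ?qpoch_le1 ?ltW ?qpoch_gt0.
Qed.

(** Induction on [M]: dividing once more by [u_k], respectively by its limit,
    preserves an error [O(q^k)], since both are bounded away from [0]. *)
Lemma ratio_dist M : exists2 C, 0 <= C & forall k l, (k <= l)%N ->
  `|qpoch q q l / qpoch q q k ^+ M - qpoch_oo / qpoch_oo ^+ M| <= C * q ^+ k.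
Proof.
have Q0 := qpoch_oo_gt0; have q1 : 0 < 1 - q by rewrite subr_gt0.
elim: M => [|M [C C0 IH]].
  exists (1 - q)^-1 => [|k l kl]; first by rewrite invr_ge0 ltW.
  rewrite !expr0 !divr1 (le_trans (qpoch_dist l))// mulrC.
  by rewrite ler_pM2l ?invr_gt0// ler_wiXn2l// ltW.
pose X := qpoch_oo / qpoch_oo ^+ M.
have X0 : 0 <= X by rewrite divr_ge0 ?exprn_ge0// ltW.
pose K := C / qpoch_oo + X / (1 - q) / (qpoch_oo * qpoch_oo).
exists K => [|k l kl].
  by rewrite /K addr_ge0 // !(divr_ge0, mulr_ge0) // ?exprn_ge0 // ltW.
rewrite !exprSr !invfM !mulrA -/X /K {K}.
have := IH k l kl; rewrite -/X; set x := _ / _ ^+ M => xX.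
have := qpoch_oo_le k; have := qpoch_dist k; have := qpoch_gt0 k.
set b := qpoch q q k => b0 bQ Qb.
(* Neither quotient may be split by the normalizations of products below. *)
clearbody X x.
have -> : x / b - X / qpoch_oo =
    (x - X) / b + X * (qpoch_oo - b) / (qpoch_oo * b).
  by field; rewrite !gt_eqF.
rewrite [leRHS]mulrDl (le_trans (ler_normD _ _))// lerD//.
  rewrite normrM [leRHS]mulrAC normfV (gtr0_norm b0).
  by rewrite ler_pM// ?invr_ge0 ?(ltW b0)// lef_pV2.
rewrite !normrM normfV !normrM (ger0_norm X0) (gtr0_norm Q0) (gtr0_norm b0).
rewrite distrC.
rewrite [leRHS]mulrAC ler_pM ?mulr_ge0//.
- by rewrite invr_ge0 mulr_ge0// ltW.
- by rewrite -mulrA ler_wpM2l// mulrC.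
- by rewrite lef_pV2 ?posrE ?mulr_gt0// ler_pM2l.
Qed.

(** The exponent is quadratic in [d = N - k], but decay at rate [q^(2d)] is
    enough to beat the error [O(q^k)] of [ratio_dist]; the constant absorbs the
    offset in [2d - 1 <= C(d+1,2)]. *)
Lemma euler_weight_bound : exists2 C, 0 <= C & forall N k, (k <= N)%N ->
  `|euler_weight q N k| <= C * q ^+ (N - k).*2.
Proof.
have Q0 := qpoch_oo_gt0; have Q2 := mulr_gt0 Q0 Q0.
exists (q * (qpoch_oo * qpoch_oo))^-1 => [|N k kN].
  by rewrite invr_ge0 mulr_ge0// ltW.
rewrite /euler_weight; set d := (N - k)%N.
rewrite !normrM normfV !normrM normrX normrN normr1 expr1n mul1r.
rewrite (gtr0_norm (qpoch_gt0 d)) (gtr0_norm (qpoch_gt0 k)).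
rewrite gtr0_norm ?exprn_gt0// (invfM q) [leRHS]mulrAC.
rewrite ler_pM//.
- by rewrite exprn_ge0// ltW.
- by rewrite invr_ge0 mulr_ge0// ltW// qpoch_gt0.
- rewrite ler_pdivlMl// -exprS ler_wiXn2l ?(ltW q_gt0) ?(ltW q_lt1)//.
  elim: d => [//|[//|d] IH]; rewrite binS2; lia.
- rewrite lef_pV2 ?posrE ?mulr_gt0 ?qpoch_gt0//.
  by rewrite ler_pM ?qpoch_oo_le// ltW.
Qed.

(** A quantitative Toeplitz argument: as the weights sum to [1], the distance
    to the limit is the weighted sum of the errors, which is at most
    [sum_k C q^(2(N-k)) D q^k = C D q^N sum_k q^(N-k)]. *)
Lemma cvg_euler_mean M :
  \sum_(k < N.+1) euler_weight q N k *
    (qpoch q q (N + k).+1 / qpoch q q k ^+ M) @[N --> \oo]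
  --> qpoch_oo / qpoch_oo ^+ M.
Proof.
have [C C0 HC] := euler_weight_bound; have [D D0 HD] := ratio_dist M.
set L := qpoch_oo / _.
have q1 : 0 < 1 - q by rewrite subr_gt0.
have bound N : `|L - \sum_(k < N.+1) euler_weight q N k *
    (qpoch q q (N + k).+1 / qpoch q q k ^+ M)| <= C * D / (1 - q) * q ^+ N.
  rewrite -[L]mul1r -[X in X * L](sum_euler_weight q_expn_neq1 N).
  rewrite mulr_suml -sumrB.
  under eq_bigr do rewrite -mulrBr.
  apply: le_trans (ler_norm_sum _ _ _) _.
  apply: (@le_trans _ _ (\sum_(k < N.+1) C * D * q ^+ N * q ^+ (N - k))).
    apply: ler_sum => k _; rewrite normrM distrC.
    have kN : (k <= N)%N by rewrite -ltnS.
    have -> : C * D * q ^+ N * q ^+ (N - k) =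
        (C * q ^+ (N - k).*2) * (D * q ^+ k).
      rewrite mulrACA -!mulrA -!exprD; congr (_ * (_ * q ^+ _)); lia.
    by rewrite ler_pM ?HC ?HD//; lia.
  rewrite -mulr_sumr [leRHS]mulrAC ler_wpM2l//.
    by rewrite !mulr_ge0// exprn_ge0// ltW.
  rewrite (reindex_inj rev_ord_inj)/=.
  rewrite (eq_bigr (fun k : 'I_N.+1 => geometric 1 q k)); last first.
    by move=> k _; rewrite /= mul1r; congr (q ^+ _); have := ltn_ord k; lia.
  rewrite -(big_mkord xpredT) -[leRHS]mul1r.
  by apply: geometric_le_lim; rewrite ?gtr0_norm.
apply/cvgrPdist_le => e e0.
have : C * D / (1 - q) * q ^+ n @[n --> \oo] --> C * D / (1 - q) * 0.
  by apply: cvgMl_tmp; exact: cvg_qn.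
rewrite mulr0 => /cvgrPdist_le/(_ _ e0); apply: filterS => N.
rewrite sub0r normrN => h; apply: (le_trans (bound N)).
by apply: le_trans h; exact: ler_norm.
Qed.

End Analysis.

(** * The product formula *)

Theorem proposition3p3 (R : realType) (m : nat) (q : R) (hq0 : 0 < q) (hq1 : q < 1) :
  let P : R^nat := fun N => \prod_(1 <= j < N.+1) (1 / (1 - q ^+ j) ^+ m) in
  let T : R^nat := fun n =>
    (-1) ^+ n * (1 - q ^+ (2 * n + 1)) * q ^+ (n * (n - 1) %/ 2)
    * qhyp n [tuple of q ^+ (n + 1) :: nseq m 0] [tuple of nseq m.+1 q] q q in
  [/\ cvgn P, cvgn (series T) & limn P = limn (series T)].
Proof.
move=> P T.
have q0 : q != 0 by rewrite gt_eqF.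
have qr := q_expn_neq1 hq0 hq1.
have Q0 : qpoch_oo q != 0 by rewrite gt_eqF// qpoch_oo_gt0.
have cP : (P @ \oo --> (qpoch_oo q ^+ m)^-1)%classic.
  have -> : P = (fun N => (qpoch q q N ^+ m)^-1).
    apply/funext => N; rewrite /P big_add1 big_mkord /qpoch -prodrXl -prodfV.
    by apply: eq_bigr => i _; rewrite div1r exprS.
  apply: cvgV; first by rewrite expf_neq0.
  exact: (@cvg_comp _ _ _ (qpoch q q) (fun x : R => x ^+ m) _ _ _
    (cvg_qpoch hq0 hq1) (@exprn_continuous R m (qpoch_oo q))).
have TE n : T n = \sum_(k < n.+1)
    ((1 - q ^+ n.*2.+1) * ((-1) ^+ (n - k) * q ^+ 'C(n - k, 2) *
     qpoch q q (n + k) / qpoch q q (n - k)) / qpoch q q k ^+ m.+2).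
  rewrite /T /qhyp mulr_sumr; apply: eq_bigr => k _.
  rewrite -(qpoch_pair qr) -1?ltnS//.
  rewrite big_ord_recl (_ : \prod_(i < m) _ = 1); last first.
    apply: big1 => i _; rewrite !(tnth_nth 0)/= nth_nseq ltn_ord.
    exact: qpoch_at0.
  rewrite (eq_bigr (fun=> qpoch q q k)); last first.
    by move=> i _; rewrite (tnth_nth 0) (nth_nseq _ m.+1) ltn_ord.
  rewrite prodr_const card_ord -exprS (tnth_nth 0)/= mulr1.
  rewrite mul2n !addn1 subn1 divn2 -bin2.
  by rewrite -!mulrA; ring.
have cT : (series T @ \oo --> (qpoch_oo q ^+ m)^-1)%classic.
  rewrite -cvg_shiftS.
  rewrite (_ : [sequence _]_n = fun N => \sum_(k < N.+1) euler_weight q N k *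
    (qpoch q q (N + k).+1 / qpoch q q k ^+ m.+1)); last first.
    (* The closed form involves [k <= N], that is [N.+1] terms of the series. *)
    apply/funext => N; rewrite /= -sum_qhyp_terms// /series/=.
    by apply: eq_bigr => n _; rewrite TE.
  have -> : (qpoch_oo q ^+ m)^-1 = qpoch_oo q / qpoch_oo q ^+ m.+1.
    by rewrite exprS invfM mulrA mulfV// mul1r.
  exact: cvg_euler_mean.
by split; [exact: cvgP cP|exact: cvgP cT|rewrite (cvg_lim _ cP)// (cvg_lim _ cT)].
Qed.
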